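(* Let $X$ be a separated topological space, $A$ a closed subset of $X$, and $T$ an upper semicontinuous multi-valued map from $A$ into $[0,1]$ with nonempty closed convex values. Suppose that at least one of the following two conditions holds: (C1) $X$ is completely normal; (C2) $X$ is normal and $A$ (with the topology induced from $X$) is perfectly normal. Then there exists an upper semicontinuous multi-valued map $\widetilde{T}$ from $X$ into $[0,1]$ with nonempty closed convex values such that $\widetilde{T}(x)=T(x)$ for every $x\in A$.
   Context: Separated means Hausdorff. Subsets are endowed with the induced topology; $[0,1]$ is the unit real interval with its usual topology. A multi-valued map $T$ from a space $E_1$ into a space $E_2$ assigns to each $x\in E_1$ a subset $T(x)\subset E_2$. It is upper semicontinuous if for every $x_0\in E_1$ and every open subset $V$ of $E_2$ with $T(x_0)\subset V$ there is a neighborhood $O$ of $x_0$ in $E_1$ such that $T(x)\subset V$ for all $x\in O$. A separated space is completely normal if every subspace of it is normal (equivalently, any subsets $P,Q$ with $\overline{P}\cap Q=P\cap\overline{Q}=\emptyset$ can be separated by disjoint open sets). A separated space is perfectly normal if each of its closed subsets is a $G_\delta$-set, i.e. a countable intersection of open sets. *)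

(* Defs.v *)
From mathcomp Require Import all_boot all_order all_algebra.
From mathcomp Require Import all_classical all_reals all_analysis.
From mathcomp Require Import borel_hierarchy.
Import numFieldNormedType.Exports.

Set Implicit Arguments.
Unset Strict Implicit.
Unset Printing Implicit Defensive.

Local Open Scope classical_set_scope.
Local Open Scope ring_scope.

Definition upper_semicontinuous {E1 E2 : topologicalType} (T : E1 -> set E2) :=
  forall (x0 : E1) (V : set E2), open V -> T x0 `<=` V ->
    \forall x \near x0, T x `<=` V.

(* A subspace is the subtype [set_type P], with its induced topology. *)
Definition completely_normal_space (X : topologicalType) :=
  hausdorff_space X /\ forall P : set X, normal_space (set_type P).

(* Normality is deliberately not part of this notion: only the Hausdorff
   property and the G_delta condition are required. *)
Definition perfectly_normal_space (X : topologicalType) :=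
  hausdorff_space X /\ forall C : set X, closed C -> Gdelta C.

Definition unit_interval (R : realType) : set R := `[0, 1]%classic.
Arguments unit_interval : clear implicits.

(* [closed] refers to the topology induced on [0, 1]; convexity is that of the
   corresponding subset of the real line. *)
Definition nonempty_closed_convex (R : realType)
    (C : set (set_type (unit_interval R))) :=
  [/\ C !=set0, closed C & convex_set (set_val @` C : set R^o)].

(* Main.v *)
(* T corresponds to the disjoint open subsets {T > t} and {T < t} of A, which
   are separated in X.  Either condition yields disjoint open subsets of X
   containing them: (C1) by normality of the complement of the intersection of
   their closures, (C2) because both are F_sigma sets of a normal space.
   For t in a sequence (q_i) dense in [0, 1] call these P_i and Q_i, and replace
   P_i by P_i minus the closures of the Q_j with j <= i and q_j <= q_i, and Q_j
   symmetrically.  No point of {T > q_i} is lost, since {T > q_i} is contained in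
   the open set P_j, which misses Q_j.  Afterwards P_i and Q_j are disjoint
   whenever q_j <= q_i, so that
     T'(x) = {y | q_i <= y if x is in P_i, and y <= q_i if x is in Q_i}
   is a nonempty closed interval; its graph is closed, hence T' is upper
   semicontinuous by compactness of [0, 1]. *)
Require Import Defs.
From mathcomp Require Import all_boot all_order all_algebra.
From mathcomp Require Import all_classical all_reals all_analysis.
From mathcomp Require Import borel_hierarchy.
Import numFieldNormedType.Exports.
Import Order.TTheory GRing.Theory Num.Theory.

Local Open Scope classical_set_scope.
Local Open Scope ring_scope.

(** * Disjointness, closures and the carving of two sequences of sets *)

Lemma disjoint_absurd {T : Type} {P Q : set T} {x : T} :
  P `&` Q = set0 -> P x -> Q x -> False.
Proof. by move=> /disjoints_subset PQ /PQ. Qed.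

Lemma disjoint_closure_open {X : topologicalType} {P Q : set X} :
  open Q -> P `&` Q = set0 -> closure P `&` Q = set0.
Proof.
move=> oQ /disjoints_subset PQ; apply/disjoints_subset.
have /closure_id -> : closed (~` Q) by exact: open_closedC.
exact: closureS.
Qed.

Lemma separated_open {X : topologicalType} {U V P Q : set X} :
  open P -> open Q -> P `&` Q = set0 -> U `<=` P -> V `<=` Q -> separated U V.
Proof.
move=> oP oQ PQ UP VQ; have QP : Q `&` P = set0 by rewrite setIC.
split; apply/disjoints_subset => x.
  move=> /(closureS UP) Px /VQ Qx.
  exact: disjoint_absurd (disjoint_closure_open oQ PQ) Px Qx.
move=> /UP Px /(closureS VQ) Qx.
exact: disjoint_absurd (disjoint_closure_open oP QP) Qx Px.
Qed.

(** The bound [j <= i] makes the removed union finite, hence closed. The relation [r] is a parameter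
    because carving serves twice: for all pairs in the F_sigma separation, and for [q j <= q i] in
    the final construction. *)
Definition carve {X : topologicalType} (r : nat -> nat -> Prop)
    (P Q : nat -> set X) (i : nat) : set X :=
  P i `\` \bigcup_(j in [set j | (j <= i)%N /\ r i j]) closure (Q j).

Lemma carve_open {X : topologicalType} r (P Q : nat -> set X) i :
  open (P i) -> open (carve r P Q i).
Proof.
move=> oP; apply: openI => //; apply/closed_openC/closed_bigcup => [|j _].
  by apply: (sub_finite_set _ (finite_II i.+1)) => j [].
exact: closed_closure.
Qed.

Lemma sub_carve {X : topologicalType} {r} {P Q : nat -> set X} {i} {U : set X} :
  U `<=` P i -> (forall j, r i j -> U `&` closure (Q j) = set0) ->
  U `<=` carve r P Q i.
Proof.
move=> UP UQ x Ux; split; first exact: UP.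
by move=> [j [_ rij] Qx]; exact: disjoint_absurd (UQ j rij) Ux Qx.
Qed.

(** Of the two sets, the one with the larger index had the closure of the other removed. The
    arguments of [r] are swapped in the second carving so that both carvings concern the same
    pairs. *)
Lemma carve_disjoint {X : topologicalType} {r : nat -> nat -> Prop}
    {P Q : nat -> set X} {i j} :
  r i j -> carve r P Q i `&` carve (fun j i => r i j) Q P j = set0.
Proof.
move=> rij; apply/disjoints_subset => x [Px nQx] [Qx nPx].
have [ji|/ltnW ij] := leqP j i.
  by apply: nQx; exists j => //; exact: subset_closure.
by apply: nPx; exists i => //; exact: subset_closure.
Qed.

(** * Separation by disjoint open sets under either condition *)

Definition open_separated {X : topologicalType} (U V : set X) :=
  exists P Q : set X,
    [/\ open P, open Q, U `<=` P, V `<=` Q & P `&` Q = set0].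

Lemma image_preimage_set_val {T : Type} {A : set T} (W : set T) :
  set_val @` (set_val @^-1` W : set (set_type A)) = A `&` W.
Proof.
apply/seteqP; split=> [_ [x Wx <-]|x [Ax Wx]]; first by split => //; exact: set_valP.
by exists (SigSub (mem_set Ax)).
Qed.

Lemma completely_normal_open_separated (R : realType) {X : topologicalType}
    {U V : set X} :
  completely_normal_space X -> separated U V -> open_separated U V.
Proof.
move=> [_ nX] [UV VU].
pose O := ~` (closure U `&` closure V).
have oO : open O by apply: closed_openC; apply: closedI; exact: closed_closure.
pose v : set_type O -> X := set_val.
have cv (W : set X) : closed (v @^-1` closure W).
  apply: closed_comp (@closed_closure _ W).
  by move=> ? _; exact: initial_continuous.
have vUV : v @^-1` closure U `&` v @^-1` closure V = set0.
  by apply/disjoints_subset => x Ux Vx; exact: (set_valP x).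
have [P [Q [oP oQ UP VQ PQ]]] :=
  (@normal_openP R _).1 (nX O) _ _ (cv U) (cv V) vUV.
(* Since [O] is open, sets open in [O] are open in [X]. Separatedness puts both [U] and [V] inside
   [O], so nothing is lost by separating there. *)
have ov (W : set (set_type O)) : open W -> open (v @` W).
  by move=> [W' oW' <-]; rewrite image_preimage_set_val; exact: openI.
have UO : U `<=` O.
  by move=> x Ux [_ Vx]; exact: disjoint_absurd VU Ux Vx.
have VO : V `<=` O.
  by move=> x Vx [Ux _]; exact: disjoint_absurd UV Ux Vx.
exists (v @` P), (v @` Q); split; [exact: ov|exact: ov| | |].
- move=> x Ux; exists (SigSub (mem_set (UO x Ux))) => //; apply: UP.
  exact: subset_closure.
- move=> x Vx; exists (SigSub (mem_set (VO x Vx))) => //; apply: VQ.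
  exact: subset_closure.
- apply/disjoints_subset => _ [x Px <-] [y Qy /val_inj yx].
  by apply: disjoint_absurd PQ Px _; rewrite -yx.
Qed.

(** Each closed piece of [U] misses [closure V], so normality gives it an open neighborhood whose
    closure misses [V], and symmetrically. Carving these countably many neighborhoods against each
    other makes the two unions disjoint. *)
Lemma normal_Fsigma_open_separated (R : realType) {X : topologicalType}
    {U V : set X} :
  normal_space X -> Fsigma U -> Fsigma V -> separated U V -> open_separated U V.
Proof.
move=> nX.
have half (C W : set X) : closed C -> C `&` closure W = set0 ->
    exists P, [/\ open P, C `<=` P & W `&` closure P = set0].
  move=> cC CW; have [P [Q [oP oQ CP WQ PQ]]] :=
    (@normal_openP R _).1 nX _ _ cC (@closed_closure _ W) CW.
  exists P; split => //; apply/disjoints_subset => x Wx Px.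
  apply: disjoint_absurd (disjoint_closure_open oQ PQ) Px _.
  exact/WQ/subset_closure.
move=> [F cF ->] [G cG ->] [FG GF].
have /choice[P hP] i : exists P, [/\ open P, F i `<=` P &
    \bigcup_i G i `&` closure P = set0].
  apply: half => //; apply/disjoints_subset => x Fx.
  by move/disjoints_subset: GF; apply; exists i.
have /choice[Q hQ] i : exists Q, [/\ open Q, G i `<=` Q &
    \bigcup_i F i `&` closure Q = set0].
  apply: half => //; apply/disjoints_subset => x Gx.
  by rewrite setIC in FG; move/disjoints_subset: FG; apply; exists i.
pose r (i j : nat) := True.
exists (\bigcup_i carve r P Q i), (\bigcup_i carve r Q P i); split.
- by apply: bigcup_open => i _; apply: carve_open; case: (hP i).
- by apply: bigcup_open => i _; apply: carve_open; case: (hQ i).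
- apply: subset_bigcup => i _; apply: sub_carve => [|j _]; first by case: (hP i).
  case: (hQ j) => _ _ /disjoints_subset h; apply/disjoints_subset => x Fx.
  by apply: h; exists i.
- apply: subset_bigcup => i _; apply: sub_carve => [|j _]; first by case: (hQ i).
  case: (hP j) => _ _ /disjoints_subset h; apply/disjoints_subset => x Gx.
  by apply: h; exists i.
- apply/disjoints_subset => x [i _ Px] [j _ Qx].
  exact: disjoint_absurd (@carve_disjoint _ r P Q i j I) Px Qx.
Qed.

Lemma closed_image_set_val {X : topologicalType} {A : set X}
    (C : set (set_type A)) :
  closed A -> closed C -> closed (set_val @` C).
Proof.
move=> cA /closed_openC [W oW WC].
rewrite -[C]setCK -WC preimage_setC image_preimage_set_val.
by apply: closedI => //; exact: open_closedC.
Qed.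

(** The complement of [U] is a G_delta set of [A]; the complements of its open factors are closed in
    [A], hence in [X] because [A] is closed. *)
Lemma perfectly_normal_open_Fsigma {X : topologicalType} {A : set X}
    (U : set (set_type A)) :
  closed A -> perfectly_normal_space (set_type A) -> open U ->
  Fsigma (set_val @` U).
Proof.
move=> cA [_ pA] oU; have [F oF UF] := pA _ (open_closedC oU).
exists (fun i => set_val @` (~` F i)).
  by move=> i; apply: closed_image_set_val => //; exact: open_closedC.
by rewrite -image_bigcup -setC_bigcap -UF setCK.
Qed.

Lemma disjoint_open_extension (R : realType) {X : topologicalType} {A : set X}
    {U V : set (set_type A)} :
  closed A ->
  completely_normal_space X \/
    (normal_space X /\ perfectly_normal_space (set_type A)) ->
  open U -> open V -> U `&` V = set0 ->
  exists P Q : set X, [/\ open P, open Q, P `&` Q = set0,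
    set_val @^-1` P = U & set_val @^-1` Q = V].
Proof.
move=> cA XA oU oV UV.
have sep (C D : set (set_type A)) : open D -> C `&` D = set0 ->
    closure (set_val @` C) `&` set_val @` D = set0.
  move=> [W oW WD] CD; have CW : set_val @` C `&` W = set0.
    apply/disjoints_subset => _ [a Ca <-] Wa.
    by apply: disjoint_absurd CD Ca _; rewrite -WD.
  apply/disjoints_subset => x Cx [a Da ax].
  apply: disjoint_absurd (disjoint_closure_open oW CW) Cx _.
  by rewrite -WD in Da; rewrite -ax.
have sUV : separated (set_val @` U) (set_val @` V).
  by split; [exact: sep|rewrite setIC; apply: sep => //; rewrite setIC].
have [P [Q [oP oQ UP VQ PQ]]] : open_separated (set_val @` U) (set_val @` V).
  case: XA => [cnX|[nX pA]]; first exact: (completely_normal_open_separated R).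
  by apply: (normal_Fsigma_open_separated R) => //;
    exact: perfectly_normal_open_Fsigma.
have [OU oOU OUE] := oU; have [OV oOV OVE] := oV.
(* [P] may meet [A] outside [U]; intersecting with an open set of trace [U] makes the trace
   exact. *)
exists (P `&` OU), (Q `&` OV); split; [exact: openI|exact: openI| | |].
- by apply/disjoints_subset => x [Px _] [Qx _]; exact: disjoint_absurd PQ Px Qx.
- by rewrite preimage_setI OUE; apply/setIidPr => a Ua; apply: UP; exists a.
- by rewrite preimage_setI OVE; apply/setIidPr => a Va; apply: VQ; exists a.
Qed.

(** * Real intervals and a dense sequence *)

Lemma convex_setP {R : realType} {S : set R} :
  convex_set (S : set R^o) <-> is_interval S.
Proof.
split=> [cS x y Sx Sy z /andP[xz zy]|iS x y t]; last first.
  rewrite !inE => Sx Sy; wlog xy : x y t Sx Sy / x <= y.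
    move=> H; case: (leP x y) => [|/ltW]; first exact: H.
    by rewrite convC; exact: H.
  by apply: iS Sx Sy _ _; have := convR_itv t xy; rewrite in_itv.
have [xy|yx] := ltP x y; last first.
  by have -> : z = x by apply/le_anti; rewrite xz (le_trans zy).
(* [factor y x z] is the weight [(z - y) / (x - y)] of [x] in [z]. Both signs are flipped to obtain
   the positive denominator [y - x]. *)
have t0 : 0 <= factor y x z.
  by rewrite /factor -mulrNN -invrN !opprB divr_ge0 ?subr_ge0// ltW.
have t1 : factor y x z <= 1.
  rewrite /factor -mulrNN -invrN !opprB ler_pdivrMr ?subr_gt0// mul1r.
  by rewrite lerD2l lerN2.
have <- : conv (Itv01 t0 t1) (x : R^o) y = z.
  by rewrite convR_line_path /= factorK// gt_eqF.
exact/set_mem/cS/mem_set/Sy/mem_set.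
Qed.

Lemma unit_interval_dense_sequence (R : realType) : exists q : nat -> R,
  (forall i, 0 <= q i <= 1) /\
  forall a b, 0 <= a -> a < b -> b <= 1 -> exists i, a < q i < b.
Proof.
(* An enumeration of the rationals. Indices that code no rational, or one outside [[0, 1]], get the
   value 0, so the sequence stays in [[0, 1]]. *)
pose s i : R := if unpickle i is Some r then ratr (r : rat) else 0.
exists (fun i => if 0 <= s i <= 1 then s i else 0); split => [i|a b a0 ab b1].
  by case: ifP => //; rewrite lexx ler01.
have [r] := rat_in_itvoo ab; rewrite in_itv/= => arb; exists (pickle r).
rewrite /s pickleK; case/andP: (arb) => ar rb.
by rewrite (ltW (le_lt_trans a0 ar)) (ltW (lt_le_trans rb b1)).
Qed.

(** * Interval-valued maps with closed graph *)

Lemma closed_graph_upper_semicontinuous {X Y : topologicalType} {K : set Y}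
    {f : X -> set Y} :
  compact K ->
  (forall x y, ~ f x y -> \forall y' \near y & x' \near x, ~ f x' y') ->
  upper_semicontinuous (fun x => set_val @^-1` f x : set (set_type K)).
Proof.
move=> cK cf x _ [W oW <-] fW.
have cKW : compact (K `&` ~` W).
  by apply: compact_closedI => //; exact: open_closedC.
have KWf y : (K `&` ~` W) y -> \forall y' \near y & x' \near x, ~ f x' y'.
  move=> [Ky nWy]; apply: cf => fy; apply: nWy.
  exact: (fW (SigSub (mem_set Ky))).
(* Compactness of [K] minus [W] yields one neighborhood of [x] that works for all its points at
   once. *)
have /compact_near_coveringP ncKW := cKW.
apply: filterS (ncKW X (nbhs x) (fun x y => ~ f x y) _ KWf).
move=> x' KW y fy; apply: contrapT => nWy.
by apply: (KW (set_val y)) fy; split => //; exact: set_valP.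
Qed.

Definition cut {R : realType} {X : Type} (q : nat -> R) (P Q : nat -> set X)
    (x : X) : set R :=
  (\bigcap_(i in [set i | P i x]) `[q i, +oo[%classic) `&`
  (\bigcap_(i in [set i | Q i x]) `]-oo, q i]%classic).

Lemma cutP {R : realType} {X : Type} {q : nat -> R} {P Q : nat -> set X} {x y} :
  cut q P Q x y <-> forall i, (P i x -> q i <= y) /\ (Q i x -> y <= q i).
Proof.
split=> [[Py Qy] i|H].
  by split=> [/Py|/Qy]; rewrite /= in_itv/= ?andbT.
by split=> i /= Hi; rewrite in_itv/= ?andbT; apply H.
Qed.

Lemma cut_nonempty_closed_convex {R : realType} {X : Type} {q : nat -> R}
    {P Q : nat -> set X} (x : X) :
  (forall i, 0 <= q i <= 1) -> (forall i j, q j <= q i -> P i `&` Q j = set0) ->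
  nonempty_closed_convex
    (set_val @^-1` cut q P Q x : set (set_type (unit_interval R))).
Proof.
move=> q01 PQ; split.
(* The point chosen is the supremum of the lower bounds. Adding 0 keeps [S] nonempty and the
   supremum nonnegative when [x] lies in no [P i]. *)
- pose S := [set y | y = 0 \/ exists2 i, P i x & y = q i].
  have ubS z : 0 <= z -> (forall i, P i x -> q i <= z) -> ubound S z.
    by move=> z0 Pz _ [->|[i Pi ->]] //; exact: Pz.
  have S0 : S 0 by left.
  have supS : has_sup S.
    by split; [exists 0|exists 1; apply: ubS => // i _; case/andP: (q01 i)].
  have sup01 : unit_interval R (sup S).
    rewrite /unit_interval/= in_itv/= (sup_upper_bound supS)//=.
    by apply: ge_sup; [exists 0|apply: ubS => // i _; case/andP: (q01 i)].
  exists (SigSub (mem_set sup01)); apply/cutP => i; split=> [Pi|Qi].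
    by apply: (sup_upper_bound supS); right; exists i.
  apply: ge_sup; first by exists 0.
  apply: ubS => [|j Pj]; first by case/andP: (q01 i).
  rewrite leNgt; apply/negP => /ltW qij.
  exact: disjoint_absurd (PQ j i qij) Pj Qi.
- apply: closed_comp; first by move=> ? _; exact: initial_continuous.
  apply: closedI; apply: closed_bigI => i _.
    exact: rray_closed.
  exact: lray_closed.
- rewrite image_preimage_set_val; apply/convex_setP.
  move=> a b [Ia /cutP ca] [Ib /cutP cb] z /andP[az zb]; split.
    move: Ia Ib; rewrite /unit_interval/= !in_itv/= => /andP[a0 _] /andP[_ b1].
    by rewrite (le_trans a0 az) (le_trans zb b1).
  apply/cutP => i; split=> [/(ca i).1|/(cb i).2] h.
    exact: le_trans az.
  exact: le_trans h.
Qed.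

Lemma cut_closed_graph {R : realType} {X : topologicalType} {q : nat -> R}
    {P Q : nat -> set X} :
  (forall i, open (P i)) -> (forall i, open (Q i)) ->
  forall x y, ~ cut q P Q x y ->
    \forall y' \near y & x' \near x, ~ cut q P Q x' y'.
Proof.
move=> oP oQ x y /cutP/existsNP[i /not_andP[|] /not_implyP[Hi /negP]];
  rewrite -ltNge => yq.
- have nx := open_nbhs_nbhs (conj (oP i) Hi).
  have ny := open_nbhs_nbhs (conj (@open_lt _ _) yq).
  exists ([set y | y < q i], P i); first by split; [exact: ny|exact: nx].
  by move=> [y' x'] /= [y'q Px'] /cutP/(_ i)[/(_ Px')]; rewrite leNgt y'q.
- have nx := open_nbhs_nbhs (conj (oQ i) Hi).
  have ny := open_nbhs_nbhs (conj (@open_gt _ _) yq).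
  exists ([set y | q i < y], Q i); first by split; [exact: ny|exact: nx].
  by move=> [y' x'] /= [y'q Qx'] /cutP/(_ i)[_ /(_ Qx')]; rewrite leNgt y'q.
Qed.

(** A gap of positive length separates [y] from [C]: closedness provides its length [e], and
    convexity keeps all of [C] on one side of [y]. Any term of the dense sequence inside the gap
    then distinguishes [y] from [C]. *)
Lemma nonempty_closed_convex_separation {R : realType}
    {C : set (set_type (unit_interval R))} {y : set_type (unit_interval R)} :
  nonempty_closed_convex C -> ~ C y ->
  exists a b : R, [/\ 0 <= a, a < b, b <= 1 &
    (set_val y <= a /\ forall z, C z -> b <= set_val z) \/
    (b <= set_val y /\ forall z, C z -> set_val z <= a)].
Proof.
move=> [[z0 Cz0] /closed_openC[W oW WC] /convex_setP iC] nCy.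
have Wy : W (set_val y) by rewrite -[W _]/((set_val @^-1` W) y) WC.
have [e /= e0 eW] := (nbhs_ballP _ _).1 (open_nbhs_nbhs (conj oW Wy)).
have far z : C z -> e <= `|set_val y - set_val z|.
  move=> Cz; rewrite leNgt; apply/negP => /eW Wz.
  by have : (~` C) z by rewrite -WC.
(* Points of [C] on both sides of [y] would force [y] into [C]. *)
have side z z' : C z -> C z' -> set_val y < set_val z -> set_val y < set_val z'.
  move=> Cz Cz' yz; rewrite ltNge; apply/negP => z'y.
  have [|w Cw /val_inj wy] := iC _ _ (imageP _ Cz') (imageP _ Cz) (set_val y).
    by rewrite z'y ltW.
  by apply: nCy; rewrite -wy.
have in01 (z : set_type (unit_interval R)) : 0 <= set_val z <= 1.
  by have := set_valP z; rewrite /unit_interval/= in_itv.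
have /andP[y0 y1] := in01 y; have /andP[z00 z01] := in01 z0.
have [yz|zy] := ltP (set_val y) (set_val z0).
- have yeC z : C z -> set_val y + e <= set_val z.
    move=> Cz; have := far z Cz; rewrite distrC gtr0_norm ?lerBrDl//.
    by rewrite subr_gt0; exact: side yz.
  exists (set_val y), (set_val y + e); split; rewrite ?ltrDl//; last by left.
  exact: le_trans (yeC z0 Cz0) z01.
- have Cye z : C z -> set_val z <= set_val y - e.
    move=> Cz; have := far z Cz; rewrite ger0_norm; first by rewrite !lerBrDr addrC.
    by rewrite subr_ge0 leNgt; apply/negP => /(side z z0 Cz Cz0); rewrite ltNge zy.
  exists (set_val y - e), (set_val y); split; rewrite ?gtrBl//; last by right.
  exact: le_trans z00 (Cye z0 Cz0).
Qed.

(** * Construction of the extension *)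

Lemma preimage_upper_semicontinuous {X Y : topologicalType} {T : X -> set Y}
    {V : set Y} :
  upper_semicontinuous T -> open V -> open [set x | T x `<=` V].
Proof. by move=> uT oV; rewrite openE => x Tx; exact: uT. Qed.

Theorem theorem1 (R : realType) (X : topologicalType) (A : set X)
    (T : set_type A -> set (set_type (unit_interval R))) :
  hausdorff_space X ->
  closed A ->
  upper_semicontinuous T ->
  (forall a : set_type A, nonempty_closed_convex (T a)) ->
  completely_normal_space X \/
    (normal_space X /\ perfectly_normal_space (set_type A)) ->
  exists T' : X -> set (set_type (unit_interval R)),
    [/\ upper_semicontinuous T',
        (forall x : X, nonempty_closed_convex (T' x))
      & forall a : set_type A, T' (set_val a) = T a].
Proof.
move=> _ cA uT nT XA.
have [q [q01 qdense]] := unit_interval_dense_sequence R.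
pose above i : set (set_type (unit_interval R)) := [set y | q i < set_val y].
pose below i : set (set_type (unit_interval R)) := [set y | set_val y < q i].
pose U i := [set a | T a `<=` above i].
pose V i := [set a | T a `<=` below i].
have oU i : open (U i).
  apply: preimage_upper_semicontinuous => //.
  by exists [set t | q i < t] => //; exact: open_gt.
have oV i : open (V i).
  apply: preimage_upper_semicontinuous => //.
  by exists [set t | t < q i] => //; exact: open_lt.
have UV i : U i `&` V i = set0.
  apply/disjoints_subset => a Ua Va; have [[y Ty] _ _] := nT a.
  by have := lt_trans (Ua _ Ty) (Va _ Ty); rewrite ltxx.
have /choice[PQ hPQ] i : exists PQ : set X * set X,
    [/\ open PQ.1, open PQ.2, PQ.1 `&` PQ.2 = set0,
      set_val @^-1` PQ.1 = U i & set_val @^-1` PQ.2 = V i].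
  have [P [Q PQi]] := disjoint_open_extension R cA XA (oU i) (oV i) (UV i).
  by exists (P, Q).
pose P i := (PQ i).1; pose Q i := (PQ i).2.
have oP i : open (P i) by case: (hPQ i).
have oQ i : open (Q i) by case: (hPQ i).
have dPQ i : P i `&` Q i = set0 by case: (hPQ i).
have PU i a : P i (set_val a) <-> U i a.
  by case: (hPQ i) => _ _ _ <- _.
have QV i a : Q i (set_val a) <-> V i a.
  by case: (hPQ i) => _ _ _ _ <-.
pose r i j : Prop := q j <= q i.
pose P' := carve r P Q.
pose Q' := carve (fun j i => r i j) Q P.
have oP' i : open (P' i) by exact: carve_open.
have oQ' i : open (Q' i) by exact: carve_open.
have P'Q' i j : q j <= q i -> P' i `&` Q' j = set0.
  by move=> ji; exact: carve_disjoint.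
(* Carving leaves the trace on [A] unchanged: for [q j <= q i], [U i] lies over the open set [P j],
   which misses [closure (Q j)]. *)
have P'U i a : P' i (set_val a) <-> U i a.
  split=> [[/PU]//|Ua].
  apply: (sub_carve (U := set_val @` U i)); last by exists a.
    by move=> _ [b Ub <-]; apply/PU.
  move=> j ji; apply/disjoints_subset => _ [b Ub <-] Qb.
  have QjPj := disjoint_closure_open (oP j) (etrans (setIC _ _) (dPQ j)).
  by apply: disjoint_absurd QjPj Qb _; apply/PU => y /Ub; exact: le_lt_trans.
have Q'V i a : Q' i (set_val a) <-> V i a.
  split=> [[/QV]//|Va].
  apply: (sub_carve (U := set_val @` V i)); last by exists a.
    by move=> _ [b Vb <-]; apply/QV.
  move=> j ij; apply/disjoints_subset => _ [b Vb <-] Pb.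
  apply: disjoint_absurd (disjoint_closure_open (oQ j) (dPQ j)) Pb _.
  by apply/QV => y /Vb yq; exact: lt_le_trans yq ij.
exists (fun x => set_val @^-1` cut q P' Q' x); split.
- apply: closed_graph_upper_semicontinuous; first exact: segment_compact.
  exact: cut_closed_graph.
- by move=> x; exact: cut_nonempty_closed_convex.
- move=> a; apply/seteqP; split=> y.
    move=> /cutP cy; apply: contrapT => nTy.
    (* A value [q i] strictly inside the gap between [y] and [T a] puts [a] in [U i] or [V i], and
       the corresponding bound of [cut] excludes [y]. *)
    have [c [d [c0 cd d1]]] := nonempty_closed_convex_separation (nT a) nTy.
    have [i /andP[cq qd]] := qdense c d c0 cd d1.
    move=> [[yc dT]|[dy Tc]].
      have /P'U/(cy i).1 : U i a by move=> z /dT; exact: lt_le_trans.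
      by rewrite leNgt (le_lt_trans yc cq).
    have /Q'V/(cy i).2 : V i a by move=> z /Tc zc; exact: le_lt_trans zc cq.
    by rewrite leNgt (lt_le_trans qd dy).
  move=> Ty; apply/cutP => i; split=> [/P'U/(_ y Ty)|/Q'V/(_ y Ty)]; exact: ltW.
Qed.
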